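(* Let $p$ be a prime number, and let $f\colon\mathbb{Q}_p\to\mathbb{Q}_p$ be the map defined in the context. Then $f$ is an isometry of $\mathbb{Q}_p$ onto itself: $f$ is surjective, and $|f(x)-f(y)|_p=|x-y|_p$ for all $x,y\in\mathbb{Q}_p$.
   Context: $p$ is a fixed prime; $\mathbb{N}$ includes $0$; $v\colon\mathbb{Q}_p\to\mathbb{Z}\cup\{\infty\}$ is the $p$-adic valuation and $|x|_p=p^{-v(x)}$ for $x\neq 0$, $|0|_p=0$. Define $\epsilon(x):=|x|_p\,x\in\mathbb{Z}_p^\times$ for $x\in\mathbb{Q}_p^\times$ (here $|x|_p$ is viewed as the rational number $p^{-v(x)}$), and $\epsilon(0):=1$. Thus $x/\epsilon(x)=p^{v(x)}$ for $x\neq0$, and $0/\epsilon(0)=0$. For $x\in\mathbb{Z}_p$, $\lfloor x\rfloor_p$ is the unique element of $\{0,\ldots,p-1\}$ with $|x-\lfloor x\rfloor_p|_p<1$. Schneider's continued fraction map is $\tau\colon\mathbb{Q}_p\to\mathbb{Q}_p$, $\tau(x):=\frac{1}{\epsilon(x)}-\left\lfloor\frac{1}{\epsilon(x)}\right\rfloor_p$. The map $f\colon\mathbb{Q}_p\to\mathbb{Q}_p$ is defined by the series, convergent in $\mathbb{Q}_p$, $f(x):=\sum_{n=0}^{\infty}\left\lfloor \frac{1}{\epsilon(\tau^n(x))}\right\rfloor_p\prod_{m=0}^n\frac{\tau^m(x)}{\epsilon(\tau^m(x))}$, where $\tau^n$ is the $n$-fold iterate and $\tau^0$ is the identity. ''Isometry''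 means a surjective distance-preserving map (for the metric $|x-y|_p$). *)

(* Defs.v *)
From HB Require Import structures.
From mathcomp Require Import all_boot all_order all_algebra.
From mathcomp Require Import fraction generic_quotient.
From mathcomp Require Import boolp classical_sets topology sequences.

Set Implicit Arguments.
Unset Strict Implicit.
Unset Printing Implicit Defensive.

Import Order.TTheory GRing.Theory Num.Theory.

Local Open Scope ring_scope.

(* Z_p is the inverse limit of the rings Z/p^n, an element of Z/p^n being     *)
(* represented by its remainder in [0, p^n).                                  *)
Record padic_int (p : nat) (pr_p : prime p) := PadicInt {
  residue : nat -> int;
  _ : forall n, residue n = (residue n.+1 %% (p ^ n)%N%:Z)%Z }.

Section PadicIntRing.
Variables (p : nat) (pr_p : prime p).
Local Notation Zp := (padic_int pr_p).
Implicit Types x y z : Zp.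

HB.instance Definition _ := gen_eqMixin Zp.
HB.instance Definition _ := gen_choiceMixin Zp.

Lemma residueS x n : residue x n = (residue x n.+1 %% (p ^ n)%N%:Z)%Z.
Proof. by case: x. Qed.

Lemma padic_intP x y : residue x =1 residue y -> x = y.
Proof.
case: x y => [u hu] [w hw] /= /funext e; case: _ / e hw => hw.
by congr PadicInt; exact: Prop_irrelevance.
Qed.

Lemma residue_mod x n : (residue x n %% (p ^ n)%N%:Z)%Z = residue x n.
Proof. by rewrite residueS modz_mod. Qed.

Lemma modz_pfactor (m : int) k n : (k <= n)%N ->
  ((m %% (p ^ n)%N%:Z)%Z %% (p ^ k)%N%:Z)%Z = (m %% (p ^ k)%N%:Z)%Z.
Proof.
move=> le_kn; rewrite [m in RHS](divz_eq m (p ^ n)%N%:Z).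
have /dvdzP[q ->] : ((p ^ k)%N%:Z %| (p ^ n)%N%:Z)%Z by rewrite dvdzE dvdn_exp2l.
by rewrite mulrA modzMDl.
Qed.

Lemma residue_le x k n : (k <= n)%N ->
  residue x k = (residue x n %% (p ^ k)%N%:Z)%Z.
Proof.
elim: n => [|n IHn]; first by rewrite leqn0 => /eqP->; rewrite residue_mod.
rewrite leq_eqVlt => /predU1P[->|]; first by rewrite residue_mod.
by rewrite ltnS => le_kn; rewrite (IHn le_kn) residueS modz_pfactor.
Qed.

Definition padic_of_seq (u : nat -> int)
    (h : forall n, (u n.+1 %% (p ^ n)%N%:Z)%Z = (u n %% (p ^ n)%N%:Z)%Z) : Zp.
Proof.
exists (fun n => (u n %% (p ^ n)%N%:Z)%Z) => n.
by rewrite modz_pfactor.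
Defined.

Fact zp_const_subproof (c : int) n :
  (c %% (p ^ n)%N%:Z)%Z = (c %% (p ^ n)%N%:Z)%Z.
Proof. by []. Qed.

Fact zp_opp_subproof x n :
  (- residue x n.+1 %% (p ^ n)%N%:Z)%Z = (- residue x n %% (p ^ n)%N%:Z)%Z.
Proof. by rewrite (residueS x n) modzNm. Qed.

Fact zp_add_subproof x y n :
  ((residue x n.+1 + residue y n.+1) %% (p ^ n)%N%:Z)%Z
  = ((residue x n + residue y n) %% (p ^ n)%N%:Z)%Z.
Proof. by rewrite (residueS x n) (residueS y n) modzDm. Qed.

Fact zp_mul_subproof x y n :
  ((residue x n.+1 * residue y n.+1) %% (p ^ n)%N%:Z)%Z
  = ((residue x n * residue y n) %% (p ^ n)%N%:Z)%Z.
Proof. by rewrite (residueS x n) (residueS y n) modzMm. Qed.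

Definition zp_const c := padic_of_seq (zp_const_subproof c).
Definition zp_opp x := padic_of_seq (zp_opp_subproof x).
Definition zp_add x y := padic_of_seq (zp_add_subproof x y).
Definition zp_mul x y := padic_of_seq (zp_mul_subproof x y).

Fact zp_addA : associative zp_add.
Proof.
by move=> x y z; apply: padic_intP => n /=; rewrite modzDmr modzDml addrA.
Qed.

Fact zp_addC : commutative zp_add.
Proof. by move=> x y; apply: padic_intP => n /=; rewrite addrC. Qed.

Fact zp_add0 : left_id (zp_const 0) zp_add.
Proof.
by move=> x; apply: padic_intP => n /=; rewrite mod0z add0r residue_mod.
Qed.

Fact zp_addN : left_inverse (zp_const 0) zp_opp zp_add.
Proof. by move=> x; apply: padic_intP => n /=; rewrite modzDml addNr. Qed.

HB.instance Definition _ :=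
  GRing.isZmodule.Build Zp zp_addA zp_addC zp_add0 zp_addN.

Fact zp_mulA : associative zp_mul.
Proof.
by move=> x y z; apply: padic_intP => n /=; rewrite modzMmr modzMml mulrA.
Qed.

Fact zp_mulC : commutative zp_mul.
Proof. by move=> x y; apply: padic_intP => n /=; rewrite mulrC. Qed.

Fact zp_mul1 : left_id (zp_const 1) zp_mul.
Proof.
by move=> x; apply: padic_intP => n /=; rewrite modzMml mul1r residue_mod.
Qed.

Fact zp_mulDl : left_distributive zp_mul zp_add.
Proof.
by move=> x y z; apply: padic_intP => n /=; rewrite modzMml modzDm mulrDl.
Qed.

Fact zp_1neq0 : zp_const 1 != 0.
Proof.
apply/eqP => /(congr1 (fun z : Zp => residue z 1)) /=.
by rewrite expn1 mod0z modz_small // ltz_nat prime_gt1.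
Qed.

HB.instance Definition _ :=
  GRing.Zmodule_isComNzRing.Build Zp zp_mulA zp_mulC zp_mul1 zp_mulDl zp_1neq0.

Lemma residue0 n : residue (0 : Zp) n = 0.
Proof. exact: mod0z. Qed.

Lemma residueD x y n :
  residue (x + y) n = ((residue x n + residue y n) %% (p ^ n)%N%:Z)%Z.
Proof. by []. Qed.

Lemma residueN x n : residue (- x) n = (- residue x n %% (p ^ n)%N%:Z)%Z.
Proof. by []. Qed.

Lemma residueM x y n :
  residue (x * y) n = ((residue x n * residue y n) %% (p ^ n)%N%:Z)%Z.
Proof. by []. Qed.

Definition zp_unit : {pred Zp} := fun x => `[< exists y, y * x = 1 >].

Definition zp_inv x : Zp :=
  if pselect (exists y, y * x = 1) is left e then projT1 (cid e) else x.

Fact zp_mulVx : {in zp_unit, left_inverse 1 zp_inv *%R}.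
Proof.
move=> x /asboolP ux; rewrite /zp_inv; case: pselect => // e.
exact: (projT2 (cid e)).
Qed.

Fact zp_unitPl x y : y * x = 1 -> zp_unit x.
Proof. by move=> yx; apply/asboolP; exists y. Qed.

Fact zp_inv_out : {in [predC zp_unit], zp_inv =1 id}.
Proof.
move=> x; rewrite inE => /asboolPn nux.
by rewrite /zp_inv; case: pselect.
Qed.

HB.instance Definition _ :=
  GRing.ComNzRing_hasMulInverse.Build Zp zp_mulVx zp_unitPl zp_inv_out.

Lemma residue_neq0 x : x != 0 -> exists n, residue x n.+1 != 0.
Proof.
move=> x0; apply: contrapT => h; case/eqP: x0.
apply: padic_intP => -[|n]; rewrite residue0.
  by rewrite residueS expn0 modz1.
by apply/eqP; apply: contrapT => /negP xn; apply: h; exists n.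
Qed.

(* Junk value 0 at 0. *)
Definition zp_val x : nat :=
  if pselect (exists n, residue x n.+1 != 0) is left e then ex_minn e else 0.

Lemma le_zp_val x k : x != 0 -> (k <= zp_val x)%N = (residue x k == 0).
Proof.
move=> /residue_neq0 ex; rewrite /zp_val; case: pselect => // e.
case: ex_minnP => m xm minm; apply/idP/eqP => [|xk].
  case: k => [|k] lekm; first by rewrite residueS expn0 modz1.
  by apply/eqP; apply: contraLR lekm => /minm; rewrite -leqNgt.
rewrite leqNgt; apply: contra xm => lt_mk.
by rewrite (residue_le x lt_mk) xk mod0z.
Qed.

Lemma dvdz_residue x k n : (k <= n)%N ->
  ((p ^ k)%N%:Z %| residue x n)%Z = (residue x k == 0).
Proof. by move=> le_kn; rewrite (residue_le x le_kn); exact/dvdz_mod0P/eqP. Qed.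

Lemma logn_residue x n : x != 0 -> (zp_val x < n)%N ->
  logn p `|residue x n|%N = zp_val x.
Proof.
move=> x0 lt_xn.
have xn0 : (0 < `|residue x n|)%N by rewrite absz_gt0 -le_zp_val // -ltnNge.
have h k : (k <= n)%N -> (k <= logn p `|residue x n|)%N = (k <= zp_val x)%N.
  by move=> lekn; rewrite -pfactor_dvdn // le_zp_val // -(dvdz_residue x lekn).
apply/eqP; rewrite eqn_leq (h _ (ltnW lt_xn)) leqnn andbT.
by rewrite leqNgt h // ltnn.
Qed.

Lemma zp_val_mul x y : x != 0 -> y != 0 ->
  x * y != 0 /\ zp_val (x * y) = (zp_val x + zp_val y)%N.
Proof.
move=> x0 y0; set a := zp_val x; set b := zp_val y.
have h k : (k <= (a + b).+1)%N -> (residue (x * y) k == 0) = (k <= a + b)%N.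
  move=> lek; rewrite -(dvdz_residue (x * y) lek) residueM.
  rewrite (sameP dvdz_mod0P eqP) modz_pfactor // -(sameP dvdz_mod0P eqP).
  rewrite dvdzE abszM.
  have xn : residue x (a + b).+1 != 0.
    by rewrite -le_zp_val // -ltnNge ltnS leq_addr.
  have yn : residue y (a + b).+1 != 0.
    by rewrite -le_zp_val // -ltnNge ltnS leq_addl.
  rewrite pfactor_dvdn ?muln_gt0 ?absz_gt0 ?xn // lognM ?absz_gt0 //.
  by rewrite !logn_residue // ltnS ?leq_addr ?leq_addl.
have xy0 : x * y != 0.
  by apply/eqP => xy; have := h _ (leqnn _); rewrite xy residue0 eqxx ltnn.
split=> //; apply/eqP; rewrite eqn_leq; apply/andP; split.
  by rewrite leqNgt le_zp_val // h // ltnn.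
by rewrite le_zp_val // h // leqnn.
Qed.

Fact zp_idomain x y : x * y = 0 -> (x == 0) || (y == 0).
Proof.
move=> /eqP xy; apply: contraLR xy; rewrite negb_or => /andP[x0 y0].
by case: (zp_val_mul x0 y0).
Qed.

HB.instance Definition _ :=
  GRing.ComUnitRing_isIntegral.Build Zp zp_idomain.

Lemma zp_valM x y : x != 0 -> y != 0 ->
  zp_val (x * y) = (zp_val x + zp_val y)%N.
Proof. by move=> x0 y0; case: (zp_val_mul x0 y0). Qed.

Lemma zp_valD x y : x != 0 -> y != 0 -> x + y != 0 ->
  (minn (zp_val x) (zp_val y) <= zp_val (x + y)%R)%N.
Proof.
move=> x0 y0 xy0; rewrite le_zp_val // residueD.
have /eqP-> : residue x (minn (zp_val x) (zp_val y)) == 0.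
  by rewrite -le_zp_val // geq_minl.
have /eqP-> : residue y (minn (zp_val x) (zp_val y)) == 0.
  by rewrite -le_zp_val // geq_minr.
by rewrite addr0 mod0z.
Qed.

Lemma zp_valN x : zp_val (- x) = zp_val x.
Proof.
have [->|x0] := eqVneq x 0; first by rewrite oppr0.
have Nx0 : - x != 0 by rewrite oppr_eq0.
suff h k : (k <= zp_val (- x))%N = (k <= zp_val x)%N.
  by apply/eqP; rewrite eqn_leq -h leqnn h leqnn.
rewrite !le_zp_val // residueN -(dvdz_residue x (leqnn k)).
by rewrite -(sameP dvdz_mod0P eqP) dvdzE abszN.
Qed.

End PadicIntRing.

Definition padic (p : nat) (pr_p : prime p) : Type :=
  {fraction padic_int pr_p}.

HB.instance Definition _ (p : nat) (pr_p : prime p) :=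
  GRing.Field.on (padic pr_p).
HB.instance Definition _ (p : nat) (pr_p : prime p) :=
  isPointed.Build (padic pr_p) 0.

Section PadicAbs.
Variables (p : nat) (pr_p : prime p).
Local Notation Zp := (padic_int pr_p).
Local Notation Qp := (padic pr_p).
Local Notation "x %:F" := (@FracField.tofrac Zp x : Qp).
Implicit Types (a b : Zp) (x y z : Qp).

(* v(a / b) = v(a) - v(b); only meaningful for x != 0, as v(0) is infinite. *)
Definition padic_val x : int :=
  (zp_val \n_(repr x))%:Z - (zp_val \d_(repr x))%:Z.

Definition padic_abs x : rat := if x == 0 then 0 else p%:R ^ (- padic_val x).

Lemma padic_fracE x : x = (\n_(repr x))%:F / (\d_(repr x))%:F.
Proof.
have d0 := denom_ratioP (repr x).
rewrite -[x in LHS](@reprK _ (FracField.type Zp)) /tofrac; unlock FracField.tofrac.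
rewrite -[_^-1]FracField.pi_inv -[RHS]FracField.pi_mul.
apply/eqmodP; rewrite /= FracField.equivfE /FracField.mulf /FracField.invf /=.
by rewrite !numden_Ratio ?oner_neq0 ?mulf_neq0 ?oner_neq0 // mul1r mulr1 mulrC.
Qed.

Lemma padic_val_frac a b : a != 0 -> b != 0 ->
  padic_val (a%:F / b%:F) = (zp_val a)%:Z - (zp_val b)%:Z.
Proof.
move=> a0 b0; set x := _ / _.
have d0 : \d_(repr x) != 0 := denom_ratioP (repr x).
have x0 : x != 0 by rewrite mulf_neq0 ?invr_eq0 ?tofrac_eq0.
have xE := padic_fracE x.
have n0 : \n_(repr x) != 0.
  by apply: contraNneq x0 => n0; rewrite xE n0 tofrac0 mul0r.
have /(congr1 (@zp_val _ _)) : \n_(repr x) * b = a * \d_(repr x).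
  apply/eqP; rewrite -tofrac_eq !tofracM; apply/eqP.
  move: xE; rewrite {1}/x => /eqP.
  by rewrite eqr_div ?tofrac_eq0 // => /eqP->.
rewrite !zp_valM // /padic_val => e; apply/eqP.
by rewrite subr_eq addrAC eq_sym subr_eq -!PoszD e addnC.
Qed.

Lemma padic_abs_frac a b : a != 0 -> b != 0 ->
  padic_abs (a%:F / b%:F) = p%:R ^ ((zp_val b)%:Z - (zp_val a)%:Z).
Proof.
move=> a0 b0; rewrite /padic_abs mulf_eq0 invr_eq0 !tofrac_eq0.
by rewrite (negPf a0) (negPf b0) padic_val_frac // opprB.
Qed.

Lemma padic_fracP x : x != 0 ->
  exists a b, [/\ a != 0, b != 0 & x = a%:F / b%:F].
Proof.
move=> x0; exists \n_(repr x), \d_(repr x); split.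
- by apply: contraNneq x0 => n0; rewrite (padic_fracE x) n0 tofrac0 mul0r.
- exact: denom_ratioP.
- exact: padic_fracE.
Qed.

Let p0 : p%:R != 0 :> rat.
Proof. by rewrite pnatr_eq0 -lt0n prime_gt0. Qed.

Lemma padic_abs0 : padic_abs (0 : Qp) = 0.
Proof. by rewrite /padic_abs eqxx. Qed.

Lemma padic_abs_ge0 x : 0 <= padic_abs x.
Proof. by rewrite /padic_abs; case: ifP => // _; rewrite exprz_ge0 // ler0n. Qed.

Lemma padic_abs_eq0 x : (padic_abs x == 0) = (x == 0).
Proof.
have [->|x0] := eqVneq x 0; first by rewrite padic_abs0 eqxx.
by rewrite /padic_abs (negPf x0) expfz_eq0 (negPf p0) andbF.
Qed.

Lemma padic_absN x : padic_abs (- x) = padic_abs x.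
Proof.
have [->|/padic_fracP[a [b [a0 b0 ->]]]] := eqVneq x 0; first by rewrite oppr0.
by rewrite -mulNr -tofracN !padic_abs_frac ?oppr_eq0 // zp_valN.
Qed.

Lemma padic_absM x y : padic_abs (x * y) = padic_abs x * padic_abs y.
Proof.
have [->|/padic_fracP[a [b [a0 b0 ->]]]] := eqVneq x 0.
  by rewrite mul0r padic_abs0 mul0r.
have [->|/padic_fracP[c [d [c0 d0 ->]]]] := eqVneq y 0.
  by rewrite mulr0 padic_abs0 mulr0.
rewrite mulf_div -!tofracM !padic_abs_frac ?mulf_neq0 // -expfzDr //.
by rewrite !zp_valM // !PoszD opprD addrACA.
Qed.

Lemma padic_absD x y :
  padic_abs (x + y) <= Num.max (padic_abs x) (padic_abs y).
Proof.
have [->|x0] := eqVneq x 0; first by rewrite add0r le_max lexx orbT.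
have [->|y0] := eqVneq y 0; first by rewrite addr0 le_max lexx.
have [->|xy0] := eqVneq (x + y) 0.
  by rewrite padic_abs0 le_max padic_abs_ge0.
have [a [b [a0 b0 xE]]] := padic_fracP x0.
have [c [d [c0 d0 yE]]] := padic_fracP y0.
have ad0 : a * d != 0 by rewrite mulf_neq0.
have cb0 : c * b != 0 by rewrite mulf_neq0.
have bd0 : b * d != 0 by rewrite mulf_neq0.
have xE' : x = (a * d)%:F / (b * d)%:F.
  by rewrite xE !tofracM -mulf_div divff ?mulr1 // tofrac_eq0.
have yE' : y = (c * b)%:F / (b * d)%:F.
  rewrite yE !tofracM [b%:F * d%:F]mulrC -mulf_div divff ?mulr1 //.
  by rewrite tofrac_eq0.
have xyE : x + y = (a * d + c * b)%:F / (b * d)%:F.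
  by rewrite xE' yE' -mulrDl -tofracD.
have s0 : a * d + c * b != 0.
  by apply: contraNneq xy0 => s0; rewrite xyE s0 tofrac0 mul0r.
have p1 : 1 <= p%:R :> rat by rewrite ler1n prime_gt0.
rewrite xyE xE' yE' !padic_abs_frac // le_max.
have := zp_valD ad0 cb0 s0; rewrite geq_min => /orP[le|le]; apply/orP; [left|right];
  by rewrite ler_weXz2l // lerD2l lerN2 lez_nat.
Qed.

Lemma residue_nat (n k : nat) :
  residue (n%:R : Zp) k = (n%:Z %% (p ^ k)%N%:Z)%Z.
Proof.
elim: n => [|n IHn]; first by rewrite residue0 mod0z.
by rewrite -addn1 natrD residueD IHn modzDm PoszD.
Qed.

Lemma padic_abs_nat (n : nat) : (0 < n)%N ->
  padic_abs (n%:R : Qp) = p%:R ^- logn p n.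
Proof.
move=> n_gt0.
have h k : (residue (n%:R : Zp) k == 0) = (k <= logn p n)%N.
  by rewrite residue_nat (sameP eqP dvdz_mod0P) dvdzE pfactor_dvdn.
have n0 : n%:R != 0 :> Zp.
  by apply/eqP => n0; have := h (logn p n).+1; rewrite n0 residue0 eqxx ltnn.
have one_val : zp_val (1 : Zp) = 0%N.
  by apply: (@addnI (zp_val (1 : Zp))); rewrite -zp_valM ?oner_neq0 // mulr1 addn0.
have n_val : zp_val (n%:R : Zp) = logn p n.
  apply/eqP; rewrite eqn_leq -h -le_zp_val // leqnn /=.
  by rewrite le_zp_val // h.
have -> : n%:R = (n%:R : Zp)%:F / (1 : Zp)%:F :> Qp.
  by rewrite tofrac1 divr1 rmorph_nat.
by rewrite padic_abs_frac ?oner_neq0 // one_val n_val sub0r exprnN.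
Qed.

Let dist x y := padic_abs (x - y).

Fact padic_distxx x : dist x x = 0.
Proof. by rewrite /dist subrr padic_abs0. Qed.

Fact padic_dist_positivity x y : dist x y = 0 -> x = y.
Proof. by move=> /eqP; rewrite padic_abs_eq0 subr_eq0 => /eqP. Qed.

Fact padic_dist_sym x y : dist x y = dist y x.
Proof. by rewrite /dist -padic_absN opprB. Qed.

Fact padic_dist_triangle y x z : dist x z <= dist x y + dist y z.
Proof.
rewrite /dist -[x](subrK y) -(addrA (x - y)) (le_trans (padic_absD _ _)) //.
by rewrite subrK ge_max lerDl lerDr !padic_abs_ge0.
Qed.

HB.instance Definition _ := isMetric.Build rat Qp
  padic_distxx padic_dist_positivity padic_dist_sym padic_dist_triangle.

End PadicAbs.

Section Schneider.
Variables (p : nat) (pr_p : prime p).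
Local Notation Qp := (padic pr_p).
Implicit Types x : Qp.

(* The scalar |x|_p, a rational number, is sent into Q_p by ratr. *)
Definition padic_eps x : Qp := if x == 0 then 1 else ratr (padic_abs x) * x.

(* Junk value 0 outside Z_p. *)
Definition padic_floor x : nat :=
  if [pick a : 'I_p | padic_abs (x - (a : nat)%:R) < 1] is Some a then a else 0.

Definition schneider_map x : Qp :=
  (padic_eps x)^-1 - (padic_floor (padic_eps x)^-1)%:R.

Definition schneider_term x (n : nat) : Qp :=
  (padic_floor (padic_eps (iter n schneider_map x))^-1)%:R *
  \prod_(0 <= m < n.+1)
    (iter m schneider_map x / padic_eps (iter m schneider_map x)).

(* The limit is taken for the metric |x - y|_p. *)
Definition schneider_series x : Qp :=
  (lim (series (schneider_term x) @ \oo))%classic.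

End Schneider.

(* Main.v *)
(* Write tau for Schneider's map and, for x <> 0, v = v(x), b = floor_p(1 / eps(x)),
   so that x = p^v / (b + tau x), while the series gives f(x) = p^v (b + f (tau x)).
   Hence |f x| = |x|; and if x, y share the same v and the same b, then both
   |x - y| and |f x - f y| are p^-v times the corresponding distance for tau x,
   tau y, whereas otherwise both can be read off v and b alone and agree.
   Since |tau x| <= 1/p, iterating n times shows that the distances agree or are
   both O(p^-n), so f preserves distances.
   For surjectivity, expanding y = p^v (b + y') repeatedly yields x_n with
   |f x_n - y| <= |y| p^-n; by the isometry property (x_n) is Cauchy, and f maps
   its limit to y. *)
Require Import Defs.
From mathcomp Require Import all_boot all_order all_algebra.
From mathcomp Require Import fraction ring zify.
From mathcomp Require Import boolp classical_sets topology sequences.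

Set Implicit Arguments.
Unset Strict Implicit.

Import Order.TTheory GRing.Theory Num.Theory.
Local Open Scope ring_scope.

Lemma mulBDl (R : pzRingType) (a b s t : R) :
  a * (b + s) - a * (b + t) = a * (s - t).
Proof. by rewrite -mulrBr opprD addrACA subrr add0r. Qed.

Lemma divB_common (F : fieldType) (a u v : F) : u != 0 -> v != 0 ->
  a / u - a / v = a * (v - u) / (u * v).
Proof. by move=> u0 v0; field; rewrite u0 v0. Qed.

Section PadicNumbers.
Variables (p : nat) (pr_p : prime p).
Local Notation Zp := (padic_int pr_p).
Local Notation Qp := (padic pr_p).
Local Notation "x %:F" := (@FracField.tofrac Zp x : Qp).
Local Notation q := (p%:R^-1 : rat).
Implicit Types (a b : Zp) (x y z u : Qp).

(** * Powers of 1/p and the ultrametric inequality *)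

Lemma prime_inv_gt0 : 0 < q.
Proof. by rewrite invr_gt0 ltr0n prime_gt0. Qed.

Lemma prime_inv_lt1 : q < 1.
Proof. by rewrite invf_lt1 ?ltr1n ?ltr0n ?prime_gt1 ?prime_gt0. Qed.

Lemma prime_invX_le1 n : q ^+ n <= 1.
Proof. by rewrite exprn_ile1 // ltW ?prime_inv_gt0 ?prime_inv_lt1. Qed.

Lemma prime_invX_gt0 n : 0 < q ^+ n.
Proof. by rewrite exprn_gt0 ?prime_inv_gt0. Qed.

Lemma prime_invXE n : q ^+ n = p%:R ^ (- n%:Z).
Proof. by rewrite exprVn exprnN. Qed.

(** By the Archimedean property some n exceeds e/c when c > 0, and n < p^n. This turns estimates
    valid to every order n into exact equalities. *)
Lemma le0_of_geometric_bound (c e : rat) :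
  (forall n, c <= e * q ^+ n) -> c <= 0.
Proof.
move=> h; rewrite leNgt; apply/negP => c0.
have e0 : 0 < e by have := h 0%N; rewrite expr0 mulr1; exact: lt_le_trans.
have := archi_boundP (ltW (divr_gt0 e0 c0)).
set n := Num.bound _ => lt_n.
have lt_nX : n%:R < p%:R ^+ n :> rat by rewrite -natrX ltr_nat ltn_expl ?prime_gt1.
have := h n; rewrite leNgt => /negP; apply.
rewrite exprVn ltr_pdivrMr ?exprn_gt0 ?ltr0n ?prime_gt0 //.
by rewrite mulrC -ltr_pdivrMr // (lt_trans lt_n).
Qed.

Lemma padic_abs_gt0 x : (0 < padic_abs x) = (x != 0).
Proof. by rewrite lt_def padic_abs_ge0 andbT padic_abs_eq0. Qed.

Lemma padic_abs1 : padic_abs (1 : Qp) = 1.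
Proof. by have := padic_abs_nat pr_p (ltn0Sn 0); rewrite logn1 invr1. Qed.

Lemma padic_absV x : padic_abs x^-1 = (padic_abs x)^-1.
Proof.
have [->|x0] := eqVneq x 0; first by rewrite invr0 padic_abs0 invr0.
apply: (@mulfI _ (padic_abs x)); first by rewrite padic_abs_eq0.
by rewrite -padic_absM !divff ?padic_abs_eq0 // padic_abs1.
Qed.

Lemma padic_absBC x y : padic_abs (x - y) = padic_abs (y - x).
Proof. by rewrite -padic_absN opprB. Qed.

Lemma padic_absD_le x y c :
  padic_abs x <= c -> padic_abs y <= c -> padic_abs (x + y) <= c.
Proof. by move=> xc yc; rewrite (le_trans (padic_absD x y)) // ge_max xc. Qed.

Lemma padic_absB_le x y c :
  padic_abs x <= c -> padic_abs y <= c -> padic_abs (x - y) <= c.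
Proof. by move=> xc yc; rewrite padic_absD_le ?padic_absN. Qed.

Lemma padic_absB_trans y x z c :
  padic_abs (x - y) <= c -> padic_abs (y - z) <= c -> padic_abs (x - z) <= c.
Proof. by move=> xy yz; rewrite -(subrKA y) padic_absD_le. Qed.

Lemma padic_absD_lt x y c :
  padic_abs x < c -> padic_abs y < c -> padic_abs (x + y) < c.
Proof. by move=> xc yc; rewrite (le_lt_trans (padic_absD x y)) // gt_max xc. Qed.

(** If |x + y| < |x|, then x = (x + y) - y is a sum of two elements smaller than |x|. *)
Lemma padic_absDl x y :
  padic_abs y < padic_abs x -> padic_abs (x + y) = padic_abs x.
Proof.
move=> yx; apply/eqP; rewrite eq_le padic_absD_le ?(ltW yx) //=.
rewrite leNgt; apply/negP => h.
have := @padic_absD_lt _ _ _ h (_ : padic_abs (- y) < padic_abs x).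
by rewrite padic_absN addrK ltxx => /(_ yx).
Qed.

(** The absolute value is discrete: away from 0 it takes only integer powers of p. *)
Lemma padic_abs_lt1 x : padic_abs x < 1 -> padic_abs x <= q.
Proof.
rewrite /padic_abs; case: ifP => [_ _|_]; first exact: ltW prime_inv_gt0.
have p1 : 1 < p%:R :> rat by rewrite ltr1n prime_gt1.
rewrite -(expr0z (p%:R : rat)) ltr_eXz2l // => v0.
by rewrite -exprN1 ler_eXz2l //; lia.
Qed.

(** * Approximation by integers, and completeness *)

Lemma padic_abs_int m : padic_abs (m%:~R : Qp) <= 1.
Proof.
have h n : padic_abs (n%:R : Qp) <= 1.
  case: n => [|n]; first by rewrite padic_abs0.
  by rewrite padic_abs_nat // -exprVn prime_invX_le1.
by case: m => n; rewrite ?NegzE ?mulrNz ?padic_absN; exact: h.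
Qed.

Lemma padic_abs_tofrac a : a != 0 -> padic_abs a%:F = q ^+ zp_val a.
Proof.
move=> a0; have val1 : zp_val (1 : Zp) = 0%N.
  by apply: (@addnI (zp_val (1 : Zp))); rewrite -zp_valM ?oner_neq0 // mulr1 addn0.
by rewrite -[a%:F]divr1 -tofrac1 padic_abs_frac ?oner_neq0 // val1 sub0r prime_invXE.
Qed.

Lemma padic_abs_tofrac_le a n :
  (padic_abs a%:F <= q ^+ n) = (residue a n == 0).
Proof.
have [->|a0] := eqVneq a 0.
  by rewrite tofrac0 padic_abs0 residue0 eqxx ltW ?prime_invX_gt0.
rewrite padic_abs_tofrac // ler_iXn2l ?prime_inv_gt0 ?prime_inv_lt1 //.
exact: le_zp_val.
Qed.

Lemma residue_int (m : int) n :
  residue (m%:~R : Zp) n = (m %% (p ^ n)%N%:Z)%Z.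
Proof.
case: m => k; first exact: residue_nat.
by rewrite NegzE mulrNz residueN residue_nat modzNm.
Qed.

Lemma padic_abs_int_le (m : int) n :
  (padic_abs (m%:~R : Qp) <= q ^+ n) = ((p ^ n)%N %| m)%Z.
Proof.
have -> : m%:~R = (m%:~R : Zp)%:F :> Qp by rewrite rmorph_int.
by rewrite padic_abs_tofrac_le residue_int (sameP eqP dvdz_mod0P).
Qed.

(** Write u = a/b with v(b) <= v(a) and solve m b = a modulo a high power of p by Bezout. *)
Lemma padic_int_approx u n :
  padic_abs u <= 1 -> exists m : int, padic_abs (u - m%:~R) <= q ^+ n.
Proof.
have [->|/padic_fracP[a [b [a0 b0 ->]]]] := eqVneq u 0.
  by exists 0; rewrite subrr padic_abs0 ltW ?prime_invX_gt0.
rewrite padic_abs_frac // -(expr0z (p%:R : rat)) ler_eXz2l ?ltr1n ?prime_gt1 //.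
rewrite subr_le0 lez_nat => le_ba.
(* Dividing by b costs v(b) digits of precision, so k extra digits are kept. *)
set k := zp_val b; set N := (n + k)%N.
set A := residue a N; set B := residue b N.
have [s [t Est]] := Bezoutz B (p ^ N)%N.
(* The gcd of B and p^N is a power of p dividing b, hence a. *)
have /dvdzP[c Ac] : (gcdz B (p ^ N)%N %| A)%Z.
  have : (gcdn `|B| (p ^ N)%N %| p ^ N)%N by exact: dvdn_gcdr.
  case/(dvdn_pfactor _ _ pr_p) => j le_jN Ej.
  have : (p ^ j %| `|B|)%N by rewrite -Ej dvdn_gcdl.
  have := dvdz_residue b le_jN; rewrite dvdzE => -> /eqP bj.
  rewrite dvdzE /= Ej; have := dvdz_residue a le_jN; rewrite dvdzE => ->.
  by rewrite -le_zp_val // (leq_trans _ le_ba) // le_zp_val // bj.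
(* From A = c gcd(B, p^N) = c (s B + t p^N) one gets (c s) B = A modulo p^N. *)
exists (c * s).
have : padic_abs (a - (c * s)%:~R * b)%:F <= q ^+ N.
  rewrite padic_abs_tofrac_le residueD residueN residueM residue_int.
  rewrite modzMml -/A -/B modzNm modzDmr.
  apply/eqP/dvdz_mod0P; rewrite {}Ac -Est; apply/dvdzP; exists (c * t).
  ring.
rewrite tofracB tofracM rmorph_int.
have bF0 : b%:F != 0 by rewrite tofrac_eq0.
have -> : a%:F - (c * s)%:~R * b%:F = (a%:F / b%:F - (c * s)%:~R) * b%:F :> Qp.
  by rewrite mulrBl divfK.
rewrite padic_absM /N exprD (padic_abs_tofrac b0) -/k.
by rewrite ler_pM2r // prime_invX_gt0.
Qed.

(** Rescaling by x moves the sequence into Z_p. Integer approximations of its terms are then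
    compatible modulo the powers of p and define a point of the inverse limit. *)
Lemma padic_complete x (u : nat -> Qp) :
  (forall n, padic_abs (u n.+1 - u n) <= padic_abs x * q ^+ n) ->
  exists l, forall n, padic_abs (l - u n) <= padic_abs x * q ^+ n.
Proof.
have [->|x0] := eqVneq x 0 => du.
  have cst n : u n = u 0%N.
    elim: n => // n <-; apply/eqP; rewrite -subr_eq0 -padic_abs_eq0.
    by rewrite eq_le padic_abs_ge0 (le_trans (du n)) // padic_abs0 mul0r.
  by exists (u 0%N) => n; rewrite cst subrr padic_abs0 mul0r.
pose w n := (u n - u 0%N) / x.
have absw y n : (padic_abs (y / x) <= q ^+ n) = (padic_abs y <= padic_abs x * q ^+ n).
  by rewrite padic_absM padic_absV ler_pdivrMr ?padic_abs_gt0 // mulrC.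
have dw n : padic_abs (w n.+1 - w n) <= q ^+ n.
  by rewrite /w -mulrBl opprB addrA subrK absw.
have w1 n : padic_abs (w n) <= 1.
  elim: n => [|n IHn]; first by rewrite /w subrr mul0r padic_abs0.
  by rewrite -[w n.+1](subrK (w n)) padic_absD_le // (le_trans (dw n)) ?prime_invX_le1.
have /choice[m mP] n := padic_int_approx n (w1 n).
have mS n : (m n.+1 %% (p ^ n)%N%:Z)%Z = (m n %% (p ^ n)%N%:Z)%Z.
  apply/eqP; rewrite eqz_mod_dvd -padic_abs_int_le rmorphB /=.
  (* [m n.+1] is close to [w n.+1], which is close to [w n], which is close to [m n]. *)
  apply: (@padic_absB_trans (w n.+1)).
    rewrite padic_absBC (le_trans (mP _)) // exprS ler_piMl //.
      exact/ltW/prime_invX_gt0.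
    exact/ltW/prime_inv_lt1.
  by apply: (padic_absB_trans (dw n)).
pose l := padic_of_seq pr_p mS.
(* This undoes the normalisation in [w]. *)
exists (l%:F * x + u 0%N) => n.
have lm : padic_abs (l%:F - (m n)%:~R) <= q ^+ n.
  have -> : l%:F - (m n)%:~R = (l - (m n)%:~R)%:F :> Qp.
    by rewrite tofracB rmorph_int.
  by rewrite padic_abs_tofrac_le residueD residueN residue_int /= modzDmr
    subrr mod0z.
rewrite -absw -[l%:F * x + _ - _]addrA mulrDl mulfK // -opprB mulNr -/(w n).
by apply: padic_absB_trans lm _; rewrite padic_absBC.
Qed.

(** * Digits modulo p *)

(** Two digits at distance less than 1 from u differ by a multiple of p, hence coincide. *)
Lemma padic_floor_unique u c :
  (c < p)%N -> padic_abs (u - c%:R) < 1 -> padic_floor u = c.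
Proof.
move=> cp uc; rewrite /padic_floor; case: pickP => [d ud|/(_ (Ordinal cp))].
  have : padic_abs ((d%:Z - c%:Z)%:~R : Qp) <= q ^+ 1.
    rewrite rmorphB /= expr1; apply/padic_abs_lt1.
    by rewrite -(subrKA u) padic_absD_lt // -padic_absN opprB.
  rewrite padic_abs_int_le expn1 -eqz_mod_dvd !modz_small //; last first.
    by have := ltn_ord d; lia.
  by move/eqP=> [].
by rewrite /= uc.
Qed.

Lemma padic_floor_lt u : (padic_floor u < p)%N.
Proof. by rewrite /padic_floor; case: pickP => [d|] //=; rewrite prime_gt0. Qed.

Lemma padic_floorP u : padic_abs u <= 1 -> padic_abs (u - (padic_floor u)%:R) < 1.
Proof.
move=> /(padic_int_approx 1)[m um].
have p0 : p%:Z != 0 by have := prime_gt0 pr_p; lia.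
have [c Ec] : exists c : nat, (m %% p)%Z = c.
  by exists `|(m %% p)%Z|%N; rewrite gez0_abs // modz_ge0.
have cp : (c < p)%N by have := ltz_mod m p0; rewrite Ec; lia.
have uc : padic_abs (u - c%:R) < 1.
  apply: (@le_lt_trans _ _ (q ^+ 1)); last by rewrite expr1 prime_inv_lt1.
  apply: padic_absB_trans um _; rewrite -[c%:R]/((c%:Z)%:~R) -rmorphB.
  by rewrite padic_abs_int_le expn1 -eqz_mod_dvd -Ec modz_mod.
by rewrite (padic_floor_unique cp uc).
Qed.

Lemma padic_abs_digit c : (0 < c < p)%N -> padic_abs (c%:R : Qp) = 1.
Proof.
case/andP=> c0 cp; rewrite padic_abs_nat // lognE.
by rewrite pr_p c0 gtnNdvd // invr1.
Qed.

Lemma padic_floor_gt0 u : padic_abs u = 1 -> (0 < padic_floor u)%N.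
Proof.
move=> u1; have := @padic_floorP u; rewrite u1 => /(_ (lexx _)).
by case: padic_floor => //; rewrite subr0 u1 ltxx.
Qed.

(** * Powers of p and the unit part of x *)

Lemma ratr_primeXz (z : int) : ratr (p%:R ^ z) = p%:R ^ z :> Qp.
Proof.
case: z => n; first by rewrite -!exprnP -natrX ratr_nat natrX.
have pn0 : (p ^ n.+1)%N%:Z != 0 by rewrite eqz_nat -lt0n expn_gt0 prime_gt0.
rewrite NegzE -!exprnN -!natrX.
(* [ratr] is read off numerator and denominator, and this fraction is in lowest terms. *)
have -> : (p ^ n.+1)%:R^-1 = 1%:~R / (p ^ n.+1)%N%:Z%:~R :> rat by rewrite mul1r.
rewrite /ratr coprimeq_num ?coprimeq_den ?coprime1n //.
by rewrite (negPf pn0) mulr1 gtr0_sg ?mul1r // lt_def pn0.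
Qed.

Lemma padic_abs_primeXz (z : int) : padic_abs (p%:R ^ z : Qp) = p%:R ^ (- z).
Proof.
have h n : padic_abs (p%:R ^+ n : Qp) = q ^+ n.
  elim: n => [|n IHn]; first exact: padic_abs1.
  by rewrite !exprS padic_absM IHn padic_abs_nat ?prime_gt0 // logn_prime // eqxx.
case: z => n; first by rewrite -exprnP h prime_invXE.
by rewrite NegzE -!exprnN padic_absV h opprK -exprnP exprVn invrK.
Qed.

Lemma padic_abs_ratr_abs x : padic_abs (ratr (padic_abs x) : Qp) = (padic_abs x)^-1.
Proof.
have [->|x0] := eqVneq x 0.
  by rewrite padic_abs0 invr0 /ratr mul0r padic_abs0.
by rewrite [padic_abs x in LHS]/padic_abs [padic_abs x in RHS]/padic_abs (negPf x0)
  ratr_primeXz padic_abs_primeXz invr_expz.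
Qed.

Lemma padic_abs_eps x : padic_abs (padic_eps x) = 1.
Proof.
rewrite /padic_eps; case: eqVneq => [_|x0]; first exact: padic_abs1.
by rewrite padic_absM padic_abs_ratr_abs mulVf // padic_abs_eq0.
Qed.

Lemma padic_eps_neq0 x : padic_eps x != 0.
Proof. by rewrite -padic_abs_eq0 padic_abs_eps oner_eq0. Qed.

(* The power p ^ v(x), as an element of Q_p; it is 0 at x = 0. *)
Definition abs_repr x : Qp := (ratr (padic_abs x))^-1.

Lemma div_padic_eps x : x / padic_eps x = abs_repr x.
Proof.
rewrite /padic_eps /abs_repr; case: eqVneq => [->|x0].
  by rewrite mul0r padic_abs0 /ratr mul0r invr0.
by rewrite invfM mulrCA divff // mulr1.
Qed.

Lemma abs_repr_eps x : abs_repr x * padic_eps x = x.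
Proof. by rewrite -div_padic_eps divfK // padic_eps_neq0. Qed.

Lemma eq_abs_repr x y : padic_abs x = padic_abs y -> abs_repr x = abs_repr y.
Proof. by rewrite /abs_repr => ->. Qed.

Lemma padic_abs_repr x : padic_abs (abs_repr x) = padic_abs x.
Proof. by rewrite padic_absV padic_abs_ratr_abs invrK. Qed.

(** * One step of Schneider's expansion *)

Definition schneider_digit x : nat := padic_floor (padic_eps x)^-1.

Local Notation d := schneider_digit.
Local Notation tau := (@schneider_map p pr_p).
Local Notation S x := (series (@schneider_term p pr_p x)).
Local Notation f := (@schneider_series p pr_p).

Lemma padic_abs_epsV x : padic_abs (padic_eps x)^-1 = 1.
Proof. by rewrite padic_absV padic_abs_eps invr1. Qed.

Lemma schneider_digit_bound x : (0 < d x < p)%N.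
Proof. by rewrite padic_floor_gt0 ?padic_abs_epsV // padic_floor_lt. Qed.

Lemma padic_abs_digitB c c' : (0 < c < p)%N -> (0 < c' < p)%N -> c != c' ->
  padic_abs (c%:R - c'%:R : Qp) = 1.
Proof.
move=> /andP[_ cp] /andP[_ c'p] cc'.
have := padic_abs_int (c%:Z - c'%:Z); rewrite rmorphB /= le_eqVlt.
(* If |c - c'| < 1, both c and c' would be the floor of c. *)
case/predU1P => // /(padic_floor_unique c'p); rewrite -pmulrn => cE.
have := @padic_floor_unique c%:R c cp; rewrite subrr padic_abs0 cE => /(_ ltr01).
by move/eqP; rewrite eq_sym (negPf cc').
Qed.

Lemma padic_abs_schneider_map x : padic_abs (tau x) <= q.
Proof. by apply: padic_abs_lt1; apply: padic_floorP; rewrite padic_abs_epsV. Qed.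

Lemma schneider_mapE x : (padic_eps x)^-1 = (d x)%:R + tau x.
Proof. by rewrite /schneider_map addrC subrK. Qed.

Lemma schneider_expansion x : x = abs_repr x / ((d x)%:R + tau x).
Proof. by rewrite -schneider_mapE invrK abs_repr_eps. Qed.

Lemma padic_abs_digitD c y : (0 < c < p)%N -> padic_abs y < 1 ->
  padic_abs (c%:R + y) = 1.
Proof. by move=> /padic_abs_digit c1 y1; rewrite padic_absDl c1. Qed.

(** * Convergence of the series and its functional equation *)

(** The factor m = 0 of the product is p^v(x); the remaining factors are those of [tau x]. *)
Lemma schneider_termS x n :
  schneider_term x n.+1 = abs_repr x * schneider_term (tau x) n.
Proof.
rewrite /schneider_term big_nat_recl //= mulrCA div_padic_eps -iterS iterSr.
by congr (_ * (_ * _)); apply: eq_bigr => i _; rewrite -iterS iterSr.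
Qed.

Lemma schneider_seriesS x n :
  S x n.+1 = abs_repr x * ((d x)%:R + S (tau x) n).
Proof.
rewrite /series /= big_nat_recl // mulrDr mulr_sumr; congr (_ + _).
  by rewrite /schneider_term big_nat1 /= div_padic_eps mulrC.
by apply: eq_bigr => i _; rewrite schneider_termS.
Qed.

Lemma schneider_series0 x : S x 0%N = 0.
Proof. by rewrite /series /= big_geq. Qed.

(** Each passage from x to [tau x] gains a factor |tau x| <= 1/p. *)
Lemma schneider_series_step x n :
  padic_abs (S x n.+1 - S x n) <= padic_abs x * q ^+ n.
Proof.
elim: n x => [|n IHn] x.
  rewrite schneider_seriesS !schneider_series0 subr0 addr0 mulr1 padic_absM.
  by rewrite padic_abs_repr padic_abs_digit ?schneider_digit_bound // mulr1.
rewrite (schneider_seriesS x n.+1) (schneider_seriesS x n) mulBDl.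
rewrite padic_absM padic_abs_repr.
rewrite ler_wpM2l ?padic_abs_ge0 // (le_trans (IHn _)) // exprS.
by rewrite ler_wpM2r ?padic_abs_schneider_map // ltW ?prime_invX_gt0.
Qed.

Lemma padic_cvg_lim x (u : nat -> Qp) l :
  (forall n, padic_abs (l - u n) <= padic_abs x * q ^+ n) ->
  (lim (u @ \oo))%classic = l.
Proof.
move=> lu; apply: cvg_lim; first exact: metric_hausdorff.
apply/metricType_numDomainType.cvgrPdist_lt => e e0.
have [N NP] : exists N, padic_abs x * q ^+ N < e.
  apply: contrapT => h; have := @le0_of_geometric_bound e (padic_abs x) _.
  by rewrite leNgt e0 => /(_ _)/negP; apply=> // n; rewrite leNgt; apply/negP => ?; apply: h; exists n.
exists N => // n /= le_Nn.
apply: le_lt_trans (lu n) (le_lt_trans _ NP).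
rewrite ler_wpM2l ?padic_abs_ge0 // ler_wiXn2l //; apply/ltW.
  exact: prime_inv_gt0.
exact: prime_inv_lt1.
Qed.

Lemma schneider_series_approx x n :
  padic_abs (f x - S x n) <= padic_abs x * q ^+ n.
Proof.
have [l lP] := padic_complete (schneider_series_step x).
by rewrite /schneider_series (padic_cvg_lim lP).
Qed.

(** Both sides lie within |x| p^-n of the partial sum [S x n.+1], for every n. *)
Lemma schneider_series_rec x : f x = abs_repr x * ((d x)%:R + f (tau x)).
Proof.
apply/eqP; rewrite -subr_eq0 -padic_abs_eq0 eq_le padic_abs_ge0 andbT.
apply: (@le0_of_geometric_bound _ (padic_abs x)) => n.
apply: (@padic_absB_trans (S x n.+1)).
  rewrite (le_trans (schneider_series_approx _ _)) // ler_wpM2l ?padic_abs_ge0 //.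
  by rewrite ler_wiXn2l // ltW ?prime_inv_gt0 ?prime_inv_lt1.
rewrite schneider_seriesS mulBDl padic_absM padic_abs_repr padic_absBC.
rewrite ler_wpM2l ?padic_abs_ge0 // (le_trans (schneider_series_approx _ _)) //.
rewrite ler_piMl ?(ltW (prime_invX_gt0 _)) //.
by rewrite (le_trans (padic_abs_schneider_map x)) // ltW ?prime_inv_lt1.
Qed.

Lemma padic_abs_schneider_series x : padic_abs (f x) = padic_abs x.
Proof.
(* The approximation by the empty partial sum gives one inequality; it makes [f (tau x)] smaller
   than the unit digit. *)
have fle y : padic_abs (f y) <= padic_abs y.
  by have := schneider_series_approx y 0; rewrite schneider_series0 subr0 mulr1.
rewrite schneider_series_rec padic_absM padic_abs_repr padic_abs_digitD ?mulr1 //.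
  exact: schneider_digit_bound.
apply: le_lt_trans (fle _) (le_lt_trans (padic_abs_schneider_map x) _).
exact: prime_inv_lt1.
Qed.

(** * Preservation of distances *)

(** Inversion preserves distances between units: 1/u - 1/v = (v - u)/(uv) with |uv| = 1. *)
Lemma padic_absB_schneider x y : padic_abs x = padic_abs y ->
  padic_abs (x - y) = padic_abs x *
    padic_abs ((d x)%:R + tau x - ((d y)%:R + tau y)).
Proof.
move=> xy; have := schneider_expansion y; have := schneider_expansion x.
have := padic_abs_epsV y; have := padic_abs_epsV x.
rewrite !schneider_mapE -(eq_abs_repr xy).
move: (_ + tau x) (_ + tau y) => u v u1 v1 xE yE.
have u0 : u != 0 by rewrite -padic_abs_eq0 u1 oner_eq0.
have v0 : v != 0 by rewrite -padic_abs_eq0 v1 oner_eq0.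
have -> : x - y = abs_repr x * (v - u) / (u * v).
  by rewrite -(divB_common _ u0 v0) -xE -yE.
rewrite padic_absM padic_absM padic_abs_repr padic_absV padic_absM u1 v1.
by rewrite mulr1 invr1 mulr1 padic_absBC.
Qed.

Lemma padic_absB_schneider_series x y : padic_abs x = padic_abs y ->
  padic_abs (f x - f y) = padic_abs x *
    padic_abs ((d x)%:R + f (tau x) - ((d y)%:R + f (tau y))).
Proof.
move=> xy; rewrite [in LHS](schneider_series_rec x).
rewrite [in LHS](schneider_series_rec y) -(eq_abs_repr xy) -(@mulrBr Qp).
by rewrite padic_absM padic_abs_repr.
Qed.

Lemma padic_absDBD (c c' : nat) y z : (0 < c < p)%N -> (0 < c' < p)%N ->
  c != c' -> padic_abs y < 1 -> padic_abs z < 1 ->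
  padic_abs (c%:R + y - (c'%:R + z)) = 1.
Proof.
move=> cP c'P cc' y1 z1; have cc'1 := padic_abs_digitB cP c'P cc'.
rewrite opprD addrACA padic_absDl // cc'1.
by rewrite padic_absD_lt ?padic_absN.
Qed.

Lemma padic_absB_neq x y : padic_abs x != padic_abs y ->
  padic_abs (x - y) = Num.max (padic_abs x) (padic_abs y).
Proof.
have h u v : padic_abs v < padic_abs u -> padic_abs (u - v) = padic_abs u.
  by move=> vu; rewrite padic_absDl ?padic_absN.
by case: ltgtP => // [/h|/h] <-; rewrite // padic_absBC.
Qed.

Lemma padic_absB_max x y :
  padic_abs (x - y) <= Num.max (padic_abs x) (padic_abs y).
Proof. by rewrite -(padic_absN y) padic_absD. Qed.

(** The second alternative covers pairs whose expansions have not separated after n steps. *)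
Lemma schneider_series_isometry_upto n x y :
  let c := Num.max (padic_abs x) (padic_abs y) * q ^+ n in
  padic_abs (f x - f y) = padic_abs (x - y) \/
  padic_abs (f x - f y) <= c /\ padic_abs (x - y) <= c.
Proof.
elim: n x y => [|n IHn] x y /=.
  right; rewrite !mulr1 padic_absB_max; split=> //.
  by rewrite -(padic_abs_schneider_series x) -(padic_abs_schneider_series y)
    padic_absB_max.
have [xy|xy] := eqVneq (padic_abs x) (padic_abs y); last first.
  by left; rewrite !padic_absB_neq ?padic_abs_schneider_series.
have t1 z : padic_abs (tau z) < 1.
  exact: le_lt_trans (padic_abs_schneider_map z) prime_inv_lt1.
rewrite padic_absB_schneider_series // padic_absB_schneider //.
have [dxy|dxy] := eqVneq (d x) (d y); last first.
  left; rewrite !padic_absDBD ?padic_abs_schneider_series //;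
    exact: schneider_digit_bound.
have cancel_d s t : (d x)%:R + s - ((d y)%:R + t) = s - t :> Qp.
  by rewrite dxy opprD addrACA subrr add0r.
rewrite !cancel_d -xy maxxx.
(* The additional factor 1/p comes from the bound on [tau x] and [tau y]. *)
have step r : r <= Num.max (padic_abs (tau x)) (padic_abs (tau y)) * q ^+ n ->
    padic_abs x * r <= padic_abs x * q ^+ n.+1.
  move=> rP; rewrite ler_wpM2l ?padic_abs_ge0 // (le_trans rP) // exprS.
  rewrite ler_wpM2r ?(ltW (prime_invX_gt0 _)) //.
  by rewrite ge_max; apply/andP; split; exact: padic_abs_schneider_map.
by case: (IHn (tau x) (tau y)) => [->|[/step ? /step ?]]; [left | right].
Qed.

(** If the distances differed, both would be bounded by c p^-n for all n, so both would vanish. *)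
Lemma schneider_series_isometry x y :
  padic_abs (f x - f y) = padic_abs (x - y).
Proof.
apply: contrapT => ne; set c := Num.max (padic_abs x) (padic_abs y).
have small n : padic_abs (f x - f y) <= c * q ^+ n /\ padic_abs (x - y) <= c * q ^+ n.
  by case: (schneider_series_isometry_upto n x y).
have f0 := le0_of_geometric_bound (fun n => proj1 (small n)).
have xy0 := le0_of_geometric_bound (fun n => proj2 (small n)).
by apply: ne; apply/le_anti; rewrite (le_trans f0) ?(le_trans xy0) ?padic_abs_ge0.
Qed.

(** * Surjectivity *)

(** The argument of [f] has the valuation of y, first digit c and image z under [tau], so the
    functional equation applies. *)
Lemma schneider_series_cons y c z :
  y != 0 -> (0 < c < p)%N -> padic_abs z < 1 ->
  f (abs_repr y / (c%:R + z)) = abs_repr y * (c%:R + f z).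
Proof.
move=> y0 cP z1; have /andP[_ cp] := cP; set x := _ / _.
have w1 := padic_abs_digitD cP z1.
have xy : abs_repr x = abs_repr y.
  by apply: eq_abs_repr; rewrite padic_absM padic_abs_repr padic_absV w1 invr1 mulr1.
have y'0 : abs_repr y != 0 by rewrite -padic_abs_eq0 padic_abs_repr padic_abs_eq0.
have xE : (padic_eps x)^-1 = c%:R + z.
  by apply: invr_inj; rewrite invrK; apply: (mulfI y'0); rewrite -{1}xy abs_repr_eps.
have dx : d x = c by apply: padic_floor_unique => //; rewrite xE addrAC subrr add0r.
by rewrite schneider_series_rec xy dx /schneider_map -/(d x) dx xE addrAC subrr add0r.
Qed.

Lemma schneider_series_dense n y :
  exists x, padic_abs (f x - y) <= padic_abs y * q ^+ n.
Proof.
elim: n y => [|n IHn] y.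
  by exists y; rewrite mulr1 padic_absB_le ?padic_abs_schneider_series.
have [->|y0] := eqVneq y 0.
  by exists 0; rewrite subr0 padic_abs_schneider_series padic_abs0 mul0r.
(* The digit is that of eps(y), not of its inverse, since values of [f] expand as p^v (c + y'). *)
set c := padic_floor (padic_eps y); pose y' := padic_eps y - c%:R.
have y'1 : padic_abs y' < 1 by apply: padic_floorP; rewrite padic_abs_eps.
have cP : (0 < c < p)%N by rewrite padic_floor_gt0 ?padic_abs_eps // padic_floor_lt.
have [x' x'P] := IHn y'.
(* Needed for c to be the first digit of the new point; it follows from |x'| = |f x'| <= |y'|. *)
have x'1 : padic_abs x' < 1.
  apply: le_lt_trans y'1; rewrite -padic_abs_schneider_series -(subrK y' (f x')).
  by rewrite padic_absD_le // (le_trans x'P) // ler_piMr ?padic_abs_ge0 ?prime_invX_le1.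
exists (abs_repr y / (c%:R + x')); rewrite schneider_series_cons //.
have yE : y = abs_repr y * (c%:R + y').
  by rewrite /y' addrC subrK abs_repr_eps.
rewrite [X in _ - X]yE mulBDl padic_absM padic_abs_repr.
rewrite ler_wpM2l ?padic_abs_ge0 // (le_trans x'P) // exprS.
rewrite ler_wpM2r ?(ltW (prime_invX_gt0 _)) //.
exact: padic_abs_lt1.
Qed.

Lemma schneider_series_surjective y : exists x, f x = y.
Proof.
have /choice[x xP] n := schneider_series_dense n y.
have dx n : padic_abs (x n.+1 - x n) <= padic_abs y * q ^+ n.
  (* The approximate preimages are Cauchy because their images converge to y. *)
  rewrite -schneider_series_isometry; apply: (@padic_absB_trans y).
    rewrite (le_trans (xP _)) // ler_wpM2l ?padic_abs_ge0 //.
    by rewrite ler_wiXn2l // ltW ?prime_inv_gt0 ?prime_inv_lt1.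
  by rewrite padic_absBC.
have [l lP] := padic_complete dx.
exists l; apply/eqP; rewrite -subr_eq0 -padic_abs_eq0 eq_le padic_abs_ge0 andbT.
apply: (@le0_of_geometric_bound _ (padic_abs y)) => n.
by apply: padic_absB_trans (xP n); rewrite schneider_series_isometry.
Qed.

End PadicNumbers.

Theorem theorem2p9 (p : nat) (pr_p : prime p) :
  (forall y : padic pr_p, exists x : padic pr_p, schneider_series x = y) /\
  (forall x y : padic pr_p,
     padic_abs (schneider_series x - schneider_series y) = padic_abs (x - y)).
Proof.
by split; [exact: schneider_series_surjective | exact: schneider_series_isometry].
Qed.
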